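(* For $n\ge 0$ let $B_n=\sum_{k=0}^n\binom{n}{k}^2\binom{n+k}{k}$. The sequence $\{B_n\}_{n=0}^\infty$ is strictly 2-log-convex.
   Context: A positive sequence $\{a_n\}_{n=0}^\infty$ is log-convex if $a_n^2\le a_{n-1}a_{n+1}$ for all $n\ge 1$. It is 2-log-convex if it is log-convex and for all $n\ge 1$, $$\left(a_na_{n+2}-a_{n+1}^2\right)^2\le\left(a_{n-1}a_{n+1}-a_n^2\right)\left(a_{n+1}a_{n+3}-a_{n+2}^2\right).$$ It is strictly 2-log-convex if it is 2-log-convex and the latter inequality is strict for all $n\ge 1$. *)

(* Defs.v *)
From mathcomp Require Import all_boot all_order all_algebra.

Set Implicit Arguments.
Unset Strict Implicit.
Unset Printing Implicit Defensive.

Import Order.TTheory GRing.Theory Num.Theory.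
Local Open Scope ring_scope.

Definition positive_seq (R : realDomainType) (a : nat -> R) : Prop :=
  forall n : nat, 0 < a n.

Definition log_convex (R : realDomainType) (a : nat -> R) : Prop :=
  positive_seq a /\
  forall n : nat, (1 <= n)%N -> a n ^+ 2 <= a n.-1 * a n.+1.

Definition two_log_convex (R : realDomainType) (a : nat -> R) : Prop :=
  log_convex a /\
  forall n : nat, (1 <= n)%N ->
    (a n * a n.+2 - a n.+1 ^+ 2) ^+ 2
      <= (a n.-1 * a n.+1 - a n ^+ 2) * (a n.+1 * a n.+3 - a n.+2 ^+ 2).

Definition strictly_two_log_convex (R : realDomainType) (a : nat -> R) : Prop :=
  two_log_convex a /\
  forall n : nat, (1 <= n)%N ->
    (a n * a n.+2 - a n.+1 ^+ 2) ^+ 2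
      < (a n.-1 * a n.+1 - a n ^+ 2) * (a n.+1 * a n.+3 - a n.+2 ^+ 2).

Definition B (n : nat) : nat :=
  (\sum_(0 <= k < n.+1) 'C(n, k) ^ 2 * 'C(n + k, k))%N.

(* Main.v *)
Require Import Defs.
From mathcomp Require Import all_boot all_order all_algebra.
From mathcomp Require Import ring lra zify.
Set Implicit Arguments.
Unset Strict Implicit.
Unset Printing Implicit Defensive.
Import Order.TTheory GRing.Theory Num.Theory.
Local Open Scope ring_scope.

(** Why the theorem is true.

    Write c_n = B_(n-1) B_(n+1) - B_n^2.  By the Desnanot-Jacobi identity,
    c_n c_(n+2) - c_(n+1)^2 is B_(n+1) times the determinant of the 3 x 3
    Hankel matrix with entries B_(n-1), ..., B_(n+3) ([desnanot_jacobi]), so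
    strict 2-log-convexity says that these determinants are positive.  Plain
    log-convexity then follows: c_n c_(n+2) > c_(n+1)^2 propagates the sign of
    c_1 and c_2 to all c_n.

    The numbers B_n satisfy Apery's second-order recurrence [B_rec], proved by
    creative telescoping.  With p = n + 1, x = B_n and y = B_(n+1), it
    turns the Hankel determinant into a cubic form in (x, y) with coefficients
    polynomial in p ([hankel3E]).  Whether this form is positive is a delicate
    question: y / x tends to (11 + 5 sqrt 5) / 2, and the root of the form
    nearest to y / x is below it at a distance of order p^-4 only.  So y / x has
    to be bounded below to that precision, and also above, since a step of the
    recurrence reverses inequalities between ratios.

    Irrational expansions are avoided as follows.  If (u_n) and (v_n) are the
    dominant and the recessive solution of the recurrence, then the quadratic
    form Q_n (x, y) = (x u_(n+1) - y u_n) (x v_(n+1) - y v_n) changes under one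
    step of the recurrence by a scalar factor only, and its coefficients have
    asymptotic expansions with rational coefficients, being symmetric under
    conjugation of sqrt 5.  Cutting these expansions off gives the form
    [ratio_form]; the step relation acquires a remainder, which is computed
    in [ratio_form_step].  The exact form, being constant on (B_n) up to that
    scalar factor, is exponentially small compared with x y; so what
    [ratio_form] measures on the sequence is the truncation error, and
    p^2 [ratio_form] p x y / (x y) tends to 24.  The remainder suffices to keep
    this quotient between 16 and 40 by induction ([ratio_form_bounds_step]), and
    the lower bound 16 forces the cubic form to be positive
    ([hankel_form_gt0]). *)

Section AperyNumbers.
Variable R : realDomainType.
Implicit Types p x y z : R.

(** * The recurrence *)

Definition rec_coef (p : R) : R := 11 * p ^+ 2 + 11 * p + 3.

Definition bterm (n k : nat) : R := ('C(n, k) ^ 2 * 'C(n + k, k))%:R.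

(** The two contiguity relations are stated with their denominators cleared, so
    that they also hold where a binomial coefficient vanishes. *)
Lemma bterm_row n k : (k <= n.+1)%N ->
  (n.+1%:R - k%:R) ^+ 2 * bterm n.+1 k
  = n.+1%:R * (n.+1%:R + k%:R) * bterm n k :> R.
Proof.
move=> kn; apply: (@mulfI _ n.+1%:R); first by rewrite pnatr_eq0.
have h1 : n.+1%:R * 'C(n, k)%:R = (n.+1%:R - k%:R) * 'C(n.+1, k)%:R :> R.
  by rewrite -natrB // -!natrM mul_bin_down.
have h2 : (n.+1%:R + k%:R) * 'C(n + k, k)%:R
    = n.+1%:R * 'C(n.+1 + k, k)%:R :> R.
  by rewrite -natrD -!natrM addSn mul_bin_down -addSn addnK.
rewrite /bterm !natrM.
transitivity (((n.+1%:R - k%:R) * 'C(n.+1, k)%:R) ^+ 2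
    * (n.+1%:R * 'C(n.+1 + k, k)%:R) : R).
  by ring.
by rewrite -h1 -h2; ring.
Qed.

Lemma bterm_col n k : (k <= n)%N ->
  k.+1%:R ^+ 3 * bterm n k.+1
  = (n%:R - k%:R) ^+ 2 * (n%:R + k.+1%:R) * bterm n k :> R.
Proof.
move=> kn.
have h1 : k.+1%:R * 'C(n, k.+1)%:R = (n%:R - k%:R) * 'C(n, k)%:R :> R.
  by rewrite -natrB // -!natrM mul_bin_left.
have h2 : (n%:R + k.+1%:R) * 'C(n + k, k)%:R
    = k.+1%:R * 'C(n + k.+1, k.+1)%:R :> R.
  by rewrite -natrD -!natrM addnS mul_bin_diag.
rewrite /bterm !natrM.
transitivity ((k.+1%:R * 'C(n, k.+1)%:R) ^+ 2
    * (k.+1%:R * 'C(n + k.+1, k.+1)%:R) : R).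
  by ring.
by rewrite h1 -h2; ring.
Qed.

(** Zeilberger's certificate for the summand: the recurrence operator applied to
    [bterm] is the difference in [k] of [cert] times [bterm]. *)
Definition cert (p k : R) : R :=
  k ^+ 2 + 3 * (2 * p + 1) * k - 11 * p ^+ 2 - 9 * p - 2.

(** The range of [K] stops where the certificate can still be compared with
    [bterm n.+1 K]; the only further term of the recurrence, [bterm n.+2 n.+2],
    is added separately in [B_rec]. *)
Lemma partial_sum_telescope n K : (K <= n.+1)%N ->
  \sum_(k < K.+1) (n.+2%:R ^+ 2 * bterm n.+2 k - rec_coef n.+1%:R * bterm n.+1 k
     - n.+1%:R ^+ 2 * bterm n k)
  = cert n.+1%:R K%:R * bterm n.+1 K.
Proof.
elim: K => [|K IH] Kn.
  rewrite big_ord1 /bterm /cert /rec_coef !bin0 -(natr1 n.+1); ring.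
rewrite big_ord_recr /= IH; last by lia.
set p : R := n.+1%:R; have pE : p = n%:R + 1 by rewrite /p natr1.
set k : R := K%:R.
have up := @bterm_row n.+1 K.+1 ltac:(lia).
have down := @bterm_row n K.+1 Kn.
have left := @bterm_col n.+1 K ltac:(lia).
rewrite -!(natr1 n.+1) -!(natr1 K) -/p -/k in up down left *.
set u := bterm n.+2 K.+1 in up *; set v := bterm n.+1 K.+1 in up down left *.
set w := bterm n K.+1 in down *; set s := bterm n.+1 K in left *.
have c0 : (p + 1 - (k + 1)) ^+ 2 * (p + (k + 1)) != 0.
  rewrite mulf_neq0 // ?expf_neq0 //.
    by rewrite opprD addrACA subrr addr0 subr_eq0 /p /k eqr_nat; lia.
  by rewrite /p /k natr1 -natrD pnatr_eq0.
(* Clearing the denominators of the three contiguity relations reduces the claim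
   to a linear combination of them. *)
apply: (mulfI c0); rewrite /cert /rec_coef.
apply/eqP; rewrite -subr_eq0; apply/eqP.
transitivity ((p + (k + 1)) * (p + 1) ^+ 2
      * ((p + 1 - (k + 1)) ^+ 2 * u - (p + 1) * (p + 1 + (k + 1)) * v)
    + (p + 1 - (k + 1)) ^+ 2 * p
      * ((p - (k + 1)) ^+ 2 * v - p * (p + (k + 1)) * w)
    - cert p k * ((k + 1) ^+ 3 * v - (p - k) ^+ 2 * (p + (k + 1)) * s)).
  rewrite /cert; ring.
by rewrite up down left !subrr; ring.
Qed.

Lemma B_sum n K : (n < K)%N -> (B n)%:R = \sum_(k < K) bterm n k :> R.
Proof.
move=> nK; rewrite /B big_mkord natr_sum (big_ord_widen K (@bterm n) nK).
rewrite big_mkcond; apply: eq_bigr => k _; case: ifP => //.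
by move/negbT; rewrite -leqNgt /bterm => nk; rewrite bin_small.
Qed.

Lemma B_rec n :
  n.+2%:R ^+ 2 * (B n.+2)%:R
  = rec_coef n.+1%:R * (B n.+1)%:R + n.+1%:R ^+ 2 * (B n)%:R :> R.
Proof.
have tel := partial_sum_telescope (leqnn n.+1).
rewrite !sumrB -!mulr_sumr -(@B_sum n n.+2) // -(@B_sum n.+1 n.+2) // in tel.
have row := @bterm_row n.+1 n.+1 ltac:(lia).
have col := @bterm_col n.+2 n.+1 ltac:(lia).
have c0 : n.+2%:R != 0 :> R by rewrite pnatr_eq0.
apply: (mulfI c0).
rewrite (@B_sum n.+2 n.+3) // big_ord_recr /=.
set S := \sum_(i < n.+2) _ in tel *.
rewrite -!(natr1 n.+1) in tel row col c0 *.
set p : R := n.+1%:R in tel row col c0 *.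
have {}tel : (p + 1) ^+ 2 * S = rec_coef p * (B n.+1)%:R + p ^+ 2 * (B n)%:R
    + cert p p * bterm n.+1 n.+1 by rewrite -tel; ring.
have {}row : bterm n.+2 n.+1 = (p + 1) * (p + 1 + p) * bterm n.+1 n.+1 :> R.
  by rewrite -row; ring.
transitivity ((p + 1) * ((p + 1) ^+ 2 * S) + (p + 1) ^+ 3 * bterm n.+2 n.+2).
  by ring.
by rewrite tel col row /cert; ring.
Qed.

(** * A quadratic form controlling the ratio of consecutive terms *)

(** With N = p - 1/2, the product of the dominant and the recessive solution is,
    up to a constant and an alternating sign, N^-2 (1 - (3/100) N^-2 + O(N^-4)),
    which is approximated by 25 / end_coef p = 1 / (N^2 + 3/100).  Dividing
    [ratio_form p] by end_coef p * end_coef (p + 1) thus gives y^2 and x^2 the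
    coefficients of the conserved quadratic form, up to the truncation error. *)
Definition end_coef p : R := 25 * p ^+ 2 - 25 * p + 7.
Definition ratio_form p x y : R :=
  end_coef (p + 1) * y ^+ 2 - (275 * p ^+ 2 - 123) * x * y
  - end_coef p * x ^+ 2.

Lemma end_coef_gt0 p : 0 < end_coef p.
Proof. by have := sqr_ge0 (2 * p - 1); rewrite /end_coef; lra. Qed.

(** [p ^+ 4 * ratio_form p] divided by [end_coef p * end_coef (p + 1)] changes
    sign under one step of the recurrence, up to a remainder.  The remainder is
    a multiple of y because both outer coefficients of [ratio_form] come from
    [end_coef], which makes its x^2 part cancel. *)
Lemma ratio_form_step p x y z :
    (p + 1) ^+ 2 * z = rec_coef p * y + p ^+ 2 * x ->
  end_coef p * ((p + 1) ^+ 4 * ratio_form (p + 1) y z) =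
  y * ((6600 * p ^+ 4 + 1150 * p ^+ 3 - 2360 * p ^+ 2 - 200 * p + 350) * y
       + p ^+ 2 * (1200 * p ^+ 2 + 1200 * p + 1330) * x)
  - end_coef (p + 2) * (p ^+ 4 * ratio_form p x y).
Proof.
rewrite /ratio_form /end_coef /rec_coef => rec.
have {}rec : p ^+ 2 * x = (p + 1) ^+ 2 * z - (11 * p ^+ 2 + 11 * p + 3) * y.
  by rewrite rec; ring.
ring: rec.
Qed.

Lemma combination_ge0 (a b x y : R) :
  0 <= x -> x <= y -> 0 <= a -> 0 <= a + b -> 0 <= a * y + b * x.
Proof.
move=> x0 xy a0 ab0.
have -> : a * y + b * x = a * (y - x) + (a + b) * x by ring.
by rewrite addr_ge0 ?mulr_ge0 ?subr_ge0.
Qed.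

(** A step reverses the sign of [ratio_form], so the upper bound on one index
    gives the lower bound on the next one, and conversely.  On the sequence,
    the remainder in [ratio_form_step] exceeds the reversed term by two orders of
    magnitude, so there is room for the crude bounds 16 and 40,
    and all that is used on y / x is [x <= y]. *)
Lemma ratio_form_bounds_step p x y z : 2 <= p -> 0 <= x -> x <= y ->
    (p + 1) ^+ 2 * z = rec_coef p * y + p ^+ 2 * x ->
    16 * (x * y) <= p ^+ 2 * ratio_form p x y <= 40 * (x * y) ->
  16 * (y * z) <= (p + 1) ^+ 2 * ratio_form (p + 1) y z <= 40 * (y * z).
Proof.
move=> p2 x0 xy rec0 /andP[lo up].
have y0 := le_trans x0 xy; have p0 : 0 <= p by lra.
have rec : p ^+ 2 * x = (p + 1) ^+ 2 * z - (11 * p ^+ 2 + 11 * p + 3) * y.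
  by rewrite rec0 /rec_coef; ring.
set e := ratio_form p x y in lo up; set e' := ratio_form (p + 1) y z.
have step : end_coef p * (p + 1) ^+ 2 * ((p + 1) ^+ 2 * e') =
    end_coef p * ((p + 1) ^+ 4 * e') by ring.
have c0 : 0 < end_coef p * (p + 1) ^+ 2.
  by rewrite mulr_gt0 ?end_coef_gt0 ?exprn_gt0 //; lra.
have w0 := ltW (end_coef_gt0 (p + 2)).
have [t t0 tE] : exists2 t, 0 <= t & p = t + 2.
  by exists (p - 2); [lra | ring].
have t2 := exprn_ge0 2 t0; have t3 := exprn_ge0 3 t0; have t4 := exprn_ge0 4 t0.
(* The two polynomials in p that [combination_ge0] compares with 0 have
   nonnegative coefficients when they are written in t = p - 2. *)
apply/andP; split; rewrite -(ler_pM2l c0) -subr_ge0 step.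
- have -> : end_coef p * ((p + 1) ^+ 4 * e') -
      end_coef p * (p + 1) ^+ 2 * (16 * (y * z)) =
      end_coef (p + 2) * p ^+ 2 * (40 * (x * y) - p ^+ 2 * e) + y *
      ((2200 * p ^+ 4 + 1150 * p ^+ 3 - 392 * p ^+ 2 - 232 * p + 14) * y
       + - (200 * p ^+ 4 + 1400 * p ^+ 3 + 1062 * p ^+ 2) * x).
    rewrite /e' (ratio_form_step rec0) -/e /end_coef; ring: rec.
  rewrite addr_ge0 ?mulr_ge0 ?exprn_ge0 ?subr_ge0 //.
  by apply: combination_ge0 => //; rewrite tE; lra.
- have -> : end_coef p * (p + 1) ^+ 2 * (40 * (y * z)) -
      end_coef p * ((p + 1) ^+ 4 * e') =
      end_coef (p + 2) * p ^+ 2 * (p ^+ 2 * e - 16 * (x * y)) + y *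
      ((4400 * p ^+ 4 - 1150 * p ^+ 3 - 2560 * p ^+ 2 + 280 * p + 490) * y
       + (200 * p ^+ 4 - 1000 * p ^+ 3 - 138 * p ^+ 2) * x).
    rewrite /e' (ratio_form_step rec0) -/e /end_coef; ring: rec.
  rewrite addr_ge0 ?mulr_ge0 ?exprn_ge0 ?subr_ge0 //.
  by apply: combination_ge0 => //; rewrite tE; lra.
Qed.

(** * The Hankel determinant *)

Definition hankel3 (a b c d e : R) : R :=
  a * (c * e - d ^+ 2) - b * (b * e - c * d) + c * (b * d - c ^+ 2).

(** The Hankel determinant of five consecutive terms of a solution of the
    recurrence, with denominators cleared, in terms of its second and third
    entries. *)
Definition hankel_form p x y : R :=
  (125 * p ^+ 6 + 438 * p ^+ 5 + 509 * p ^+ 4 + 248 * p ^+ 3 + 35 * p ^+ 2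
    - 12 * p - 4) * y ^+ 3
  - (1375 * p ^+ 6 + 3477 * p ^+ 5 + 1275 * p ^+ 4 - 1410 * p ^+ 3
    - 760 * p ^+ 2 + 138 * p + 96) * x * y ^+ 2
  - (125 * p ^+ 6 - 186 * p ^+ 5 - 1052 * p ^+ 4 - 374 * p ^+ 3
    + 520 * p ^+ 2 + 378 * p + 76) * x ^+ 2 * y
  + (34 * p ^+ 5 + 51 * p ^+ 4 - 33 * p ^+ 3 - 25 * p ^+ 2) * x ^+ 3.

Lemma hankel3E p a x y d e :
    p ^+ 2 * y = rec_coef (p - 1) * x + (p - 1) ^+ 2 * a ->
    (p + 1) ^+ 2 * d = rec_coef p * y + p ^+ 2 * x ->
    (p + 2) ^+ 2 * e = rec_coef (p + 1) * d + (p + 1) ^+ 2 * y ->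
  (p - 1) ^+ 2 * (p + 1) ^+ 4 * (p + 2) ^+ 2 * hankel3 a x y d e
  = hankel_form p x y.
Proof.
move=> reca recd rece.
have {}reca : (p - 1) ^+ 2 * a = p ^+ 2 * y - rec_coef (p - 1) * x.
  by rewrite reca; ring.
have {}rece : (p + 1) ^+ 2 * ((p + 2) ^+ 2 * e) =
    rec_coef (p + 1) * (rec_coef p * y + p ^+ 2 * x) + (p + 1) ^+ 4 * y.
  by rewrite rece -recd; ring.
rewrite /hankel3.
(* Distribute the denominators so that a, d and e occur only in the products
   that the recurrence evaluates. *)
transitivity (((p - 1) ^+ 2 * a)
      * ((p + 1) ^+ 2 * y * ((p + 1) ^+ 2 * ((p + 2) ^+ 2 * e))
         - (p + 2) ^+ 2 * ((p + 1) ^+ 2 * d) ^+ 2)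
  - (p - 1) ^+ 2 * (p + 1) ^+ 2 * x * (x * ((p + 1) ^+ 2 * ((p + 2) ^+ 2 * e))
     - (p + 2) ^+ 2 * y * ((p + 1) ^+ 2 * d))
  + (p - 1) ^+ 2 * (p + 1) ^+ 2 * (p + 2) ^+ 2 * y *
    (x * ((p + 1) ^+ 2 * d) - (p + 1) ^+ 2 * y ^+ 2)); first by ring.
rewrite reca recd rece /hankel_form /rec_coef; ring.
Qed.

(** The proof divides the cubic form by p^2 [ratio_form] - 16 x y: for p at
    least 2, the linear quotient is nonnegative when 0 <= x <= y, and the
    remainder is x times a quadratic form with positive coefficients. *)
Lemma hankel_form_gt0 p x y : 2 <= p -> 0 < x -> x <= y ->
  16 * (x * y) <= p ^+ 2 * ratio_form p x y -> 0 < hankel_form p x y.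
Proof.
move=> p2 x0 xy lo; have y0 := lt_le_trans x0 xy.
have c0 : 0 < end_coef (p + 1) * p ^+ 2.
  by rewrite mulr_gt0 ?end_coef_gt0 ?exprn_gt0 //; lra.
have [t t0 tE] : exists2 t, 0 <= t & p = t + 2.
  by exists (p - 2); [lra | ring].
have t2 := exprn_ge0 2 t0; have t3 := exprn_ge0 3 t0; have t4 := exprn_ge0 4 t0.
have t5 := exprn_ge0 5 t0; have t6 := exprn_ge0 6 t0.
rewrite -(pmulr_rgt0 _ c0).
have -> : end_coef (p + 1) * p ^+ 2 * hankel_form p x y =
  ((125 * p ^+ 6 + 438 * p ^+ 5 + 509 * p ^+ 4 + 248 * p ^+ 3 + 35 * p ^+ 2
    - 12 * p - 4) * y
   + - (34 * p ^+ 5 + 119 * p ^+ 4 + 137 * p ^+ 3 + 56 * p ^+ 2 - 39 * p) * x) *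
    (p ^+ 2 * ratio_form p x y - 16 * (x * y))
  + ((p ^+ 6 + 8 * p ^+ 5 + 1626 * p ^+ 4 + 1805 * p ^+ 3 + 380 * p ^+ 2
      - 192 * p - 64) * (x * y ^+ 2)
     + (1189 * p ^+ 6 + 7761 * p ^+ 5 - 9561 * p ^+ 4 - 11519 * p ^+ 3
        - 1456 * p ^+ 2 + 624 * p) * (x ^+ 2 * y)
     + (99 * p ^+ 6 + 560 * p ^+ 5 - 1542 * p ^+ 4 + 273 * p ^+ 3) * x ^+ 3).
  rewrite /hankel_form /ratio_form /end_coef; ring.
rewrite ltr_wpDl //.
  rewrite mulr_ge0 ?subr_ge0 //.
  by apply: combination_ge0 => //; [exact: ltW | rewrite tE; lra ..].
by rewrite !addr_gt0 // mulr_gt0 ?mulr_gt0 ?exprn_gt0 // tE; lra.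
Qed.

Lemma desnanot_jacobi (a b c d e : R) :
  (a * c - b ^+ 2) * (c * e - d ^+ 2) - (b * d - c ^+ 2) ^+ 2
  = c * hankel3 a b c d e.
Proof. by rewrite /hankel3; ring. Qed.

(** * The sequence B *)

Local Notation b n := ((B n)%:R : R).

Lemma b_gt0 n : 0 < b n.
Proof. by rewrite ltr0n /B big_nat_recl // !bin0. Qed.

Lemma B_init : [/\ B 0 = 1, B 1 = 3, B 2 = 19 & B 3 = 147]%N.
Proof. by rewrite /B; split; rewrite unlock. Qed.

Lemma b_le n : b n.+1 <= b n.+2.
Proof.
have c0 : 0 < n.+2%:R ^+ 2 :> R by rewrite exprn_gt0 ?ltr0n.
rewrite -(ler_pM2l c0) B_rec -subr_ge0 -(natr1 n.+1).
set p : R := n.+1%:R; have p0 : 0 <= p by rewrite ler0n.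
have -> : rec_coef p * b n.+1 + p ^+ 2 * b n - (p + 1) ^+ 2 * b n.+1
    = (10 * p ^+ 2 + 9 * p + 2) * b n.+1 + p ^+ 2 * b n.
  by rewrite /rec_coef; ring.
by rewrite addr_ge0 ?mulr_ge0 ?exprn_ge0 ?(ltW (b_gt0 _)) //; nra.
Qed.

Lemma b_ratio_form_bounds n :
  16 * (b n.+1 * b n.+2) <= n.+2%:R ^+ 2 * ratio_form n.+2%:R (b n.+1) (b n.+2)
    <= 40 * (b n.+1 * b n.+2).
Proof.
elim: n => [|n IH].
  have [_ -> -> _] := B_init; rewrite /ratio_form /end_coef.
  by apply/andP; split; lra.
rewrite -(natr1 n.+2); apply: ratio_form_bounds_step IH.
- by rewrite ler_nat.
- exact/ltW/b_gt0.
- exact: b_le.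
- by rewrite natr1; exact: B_rec.
Qed.

Lemma b_hankel3_gt0 n : 0 < hankel3 (b n) (b n.+1) (b n.+2) (b n.+3) (b n.+4).
Proof.
have /andP[lo _] := b_ratio_form_bounds n.
have p2 : 2 <= n.+2%:R :> R by rewrite ler_nat.
have form_gt0 := hankel_form_gt0 p2 (b_gt0 n.+1) (b_le n) lo.
have p1E : n.+2%:R - 1 = n.+1%:R :> R by rewrite -natr1 addrK.
have p2E : n.+4%:R = n.+2%:R + 2 :> R by rewrite -natrD addn2.
have rec1 := B_rec n; have rec2 := B_rec n.+1; have rec3 := B_rec n.+2.
rewrite -p1E in rec1; rewrite -(natr1 n.+2) in rec2.
rewrite p2E -(natr1 n.+2) in rec3.
rewrite -(hankel3E rec1 rec2 rec3) in form_gt0.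
have den_gt0 : 0 < (n.+2%:R - 1) ^+ 2 * (n.+2%:R + 1) ^+ 4
    * (n.+2%:R + 2) ^+ 2 :> R.
  by rewrite 2?mulr_gt0 ?exprn_gt0 //; lra.
by rewrite (pmulr_rgt0 _ den_gt0) in form_gt0.
Qed.

(** * From strict inequalities to strict 2-log-convexity *)

Lemma b_two_log_convex_lt n :
  (b n.+1 * b n.+3 - b n.+2 ^+ 2) ^+ 2
  < (b n * b n.+2 - b n.+1 ^+ 2) * (b n.+2 * b n.+4 - b n.+3 ^+ 2).
Proof.
by rewrite -subr_gt0 desnanot_jacobi mulr_gt0 ?b_gt0 ?b_hankel3_gt0.
Qed.

(** Two consecutive positive values are carried along: the strict inequality
    makes the product of the values at [n] and [n.+2] positive. *)
Lemma b_log_convex_gt0 n : 0 < b n * b n.+2 - b n.+1 ^+ 2.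
Proof.
suff [] : 0 < b n * b n.+2 - b n.+1 ^+ 2
        /\ 0 < b n.+1 * b n.+3 - b n.+2 ^+ 2 by [].
elim: n => [|n [c0 c1]].
  by have [-> -> -> ->] := B_init; split; lra.
split=> //; rewrite -(pmulr_rgt0 _ c0).
exact: le_lt_trans (sqr_ge0 _) (b_two_log_convex_lt n).
Qed.

End AperyNumbers.

Theorem theorem5p2 (R : realDomainType) :
  strictly_two_log_convex (fun n : nat => (B n)%:R : R).
Proof.
split=> [|[//|n] _]; last exact: b_two_log_convex_lt.
split=> [|[//|n] _]; last exact/ltW/b_two_log_convex_lt.
split=> [n|[//|n] _]; first exact: b_gt0.
by rewrite -subr_ge0; exact/ltW/b_log_convex_gt0.
Qed.
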